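(* There exist positive constants $c$ and $C$, independent of $\alpha$, such that for every $\alpha>0$ and all nonzero $x\in\mathcal{V}$, $$c\;\le\;\sup_{0\ne y\in\mathcal{V}}\frac{\langle\mathcal{A}_\alpha x,y\rangle}{\|x\|_{\mathcal{V}}\,\|y\|_{\mathcal{V}}}\;\le\;C .$$
   Context: $W$, $U$, $O$ are real Hilbert spaces ($W$ is both the control space and the dual space, $U$ the state space, $O$ the observation space), and primes denote dual spaces and dual operators. Assume: (i) $A:U\to W'$ is a continuous linear operator with closed range; in particular there is a constant $c_1$ such that for all $u\in U$, $\inf_{\tilde u\in\operatorname{Ker}A}\|u-\tilde u\|_U\le c_1\|Au\|_{W'}$. (ii) $T:U\to O$ is linear and bounded, and there is a constant $c_2$ such that $\|u\|_U\le c_2\|Tu\|_O$ for all $u\in\operatorname{Ker}A$. Define $M:W\to W'$ by $\langle Mf,\psi\rangle=(f,\psi)_W$ and $K:U\to U'$ by $\langle Ku,\phi\rangle=(Tu,T\phi)_O$. For $\alpha>0$ let $$\mathcal{A}_\alpha=\begin{bmatrix}\alpha M&0&M'\\ 0&K&A'\\ M&A&0\end{bmatrix},$$ acting on $(f,u,w)\in W\times U\times W$, i.e. $$\langle\mathcal{A}_\alpha(f,u,w),(\psi,\phi,\xi)\rangle=\alpha(f,\psi)_W+(\psi,w)_W+(Tu,T\phi)_O+\langle A\phi,w\rangle+(f,\xi)_W+\langle Au,\xi\rangle .$$ This is the operator of the optimality (KKT) system of the problem of minimizing $\frac12\|Tu-d\|_O^2+\frac{\alpha}{2}\|f\|_W^2$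 over $f\in W$, $u\in U$ subject to $\langle Au,w\rangle+(f,w)_W=0$ for all $w\in W$. Let $W_\alpha$, $U_\alpha$, $W_{\alpha^{-1}}$ be the spaces $W$, $U$, $W$ equipped with the norms given by $$\|f\|_{W_\alpha}^2=\alpha\|f\|_W^2,\qquad\|u\|_{U_\alpha}^2=\alpha\|Au\|_{W'}^2+\|Tu\|_O^2,\qquad\|w\|_{W_{\alpha^{-1}}}^2=\tfrac1\alpha\|w\|_W^2$$ (under (i) and (ii), $\|\cdot\|_{U_\alpha}$ is a norm on $U$ equivalent to $\|\cdot\|_U$). Put $\mathcal{V}=W_\alpha\times U_\alpha\times W_{\alpha^{-1}}$, with the norm whose square is the sum of the squares of the component norms. *)

(* Defs.v *)
From HB Require Import structures.
From mathcomp Require Import all_boot all_order all_algebra.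
From mathcomp Require Import sesquilinear ring lra.
From mathcomp Require Import all_classical all_reals all_analysis.
Set Implicit Arguments.
Unset Strict Implicit.
Unset Printing Implicit Defensive.
Import Order.TTheory GRing.Theory Num.Theory.
Import numFieldNormedType.Exports.
Local Open Scope classical_set_scope.
Local Open Scope ring_scope.

(* A real Hilbert space: a Banach space whose norm comes from a symmetric
   positive definite bilinear form. *)
HB.mixin Record CompleteNormedModule_isHilbert (R : realType) V
    & CompleteNormedModule R V := {
  inner : {dot V for (@idfun R)} ;
  normr_inner : forall x : V, `|x| ^+ 2 = inner x x
}.

#[short(type="hilbertType")]
HB.structure Definition Hilbert (R : realType) :=
  {V of CompleteNormedModule R V & CompleteNormedModule_isHilbert R V}.

Section LinCont.
Context {R : realType} {V W : normedModType R}.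

Definition lincont_pred : {pred V -> W} :=
  fun f => `[< linear f /\ continuous f >].

(* The space of bounded linear operators from V to W, with the operator
   norm. *)
Record lincont := LinCont {
  lincont_fun :> V -> W ;
  lincont_funP : lincont_fun \in lincont_pred }.

HB.instance Definition _ := [isSub for lincont_fun].
HB.instance Definition _ := [Choice of lincont by <:].

Lemma lincont_submod : submod_closed lincont_pred.
Proof.
split => [|a f g /asboolP[lf cf] /asboolP[lg cg]]; apply/asboolP; split.
- by move=> a x y /=; rewrite scaler0 addr0.
- by move=> x; exact: cvg_cst.
- move=> b x y; rewrite !fctE lf lg !scalerDr addrACA; congr (_ + _ + _).
  by rewrite !scalerA mulrC.
- move=> x; apply: cvgD; last exact: cg.
  by apply: cvgZ; [exact: cvg_cst|exact: cf].
Qed.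

HB.instance Definition _ :=
  GRing.isSubmodClosed.Build R (V -> W) lincont_pred lincont_submod.
HB.instance Definition _ := [SubChoice_isSubLmodule of lincont by <:].

Lemma lincont_linear (f : lincont) : linear f.
Proof. by case: f => f /= /asboolP[]. Qed.

HB.instance Definition _ (f : lincont) :=
  GRing.isLinear.Build R V W *:%R f (lincont_linear f).

Lemma lincont_continuous (f : lincont) : continuous f.
Proof. by case: f => f /= /asboolP[]. Qed.

Lemma lincontP (f g : lincont) : f =1 g -> f = g.
Proof. by move=> fg; apply/val_inj/funext. Qed.

Lemma lincont_bounded (f : lincont) :
  exists2 M, 0 <= M & forall x, `|f x| <= M * `|x|.
Proof.
have /linear_boundedP : bounded_near f (nbhs 0).
  exact/continuous_linear_bounded/lincont_continuous.
by move=> /pinfty_ex_gt0[M M0 fM]; exists M => //; exact: ltW.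
Qed.

Lemma bounded_lincont (f : V -> W) : linear f ->
  (exists M, forall x, `|f x| <= M * `|x|) -> f \in lincont_pred.
Proof.
move=> lf [M fM]; apply/asboolP; split=> //.
pose g : {linear V -> W} := HB.pack f (GRing.isLinear.Build R V W *:%R f lf).
apply: (@bounded_linear_continuous _ _ _ g); apply/linear_boundedP.
by exists M; split=> [|r Mr x]; rewrite ?num_real// (le_trans (fM x))//
  ler_wpM2r// ltW.
Qed.

Definition opnorm (f : lincont) : R :=
  sup [set `|f x| | x in [set x : V | `|x| <= 1]].

Lemma opnorm_has_sup (f : lincont) :
  has_sup [set `|f x| | x in [set x : V | `|x| <= 1]].
Proof.
split; first by exists `|f 0|, 0 => //=; rewrite normr0.
have [M M0 fM] := lincont_bounded f; exists M => _ [x /= x1 <-].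
by rewrite (le_trans (fM x))// ler_piMr.
Qed.

Lemma opnorm_ub (f : lincont) x : `|x| <= 1 -> `|f x| <= opnorm f.
Proof.
by move=> x1; apply: (sup_ubound (opnorm_has_sup f).2); exists x.
Qed.

Lemma opnorm_le (f : lincont) M :
  (forall x, `|x| <= 1 -> `|f x| <= M) -> opnorm f <= M.
Proof.
move=> fM; apply: ge_sup; first exact: (opnorm_has_sup f).1.
by move=> _ [x x1 <-]; exact: fM.
Qed.

Lemma ler_opnorm (f : lincont) x : `|f x| <= opnorm f * `|x|.
Proof.
have [->|x0] := eqVneq x 0; first by rewrite linear0 !normr0 mulr0.
have nx : 0 < `|x| by rewrite normr_gt0.
have := @opnorm_ub f (`|x|^-1 *: x).
rewrite linearZ/= !normrZ normrV ?unitfE ?gt_eqF// normr_id mulVf ?gt_eqF//.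
by move=> /(_ (lexx _)); rewrite mulrC ler_pdivrMr.
Qed.

Lemma opnormD f g : opnorm (f + g) <= opnorm f + opnorm g.
Proof.
apply: opnorm_le => x x1; rewrite (le_trans (ler_normD _ _))//.
by rewrite lerD// opnorm_ub.
Qed.

Lemma opnormZ a f : opnorm (a *: f) = `|a| * opnorm f.
Proof.
have le b g : opnorm (b *: g) <= `|b| * opnorm g.
  by apply: opnorm_le => x x1; rewrite normrZ ler_wpM2l// opnorm_ub.
apply/eqP; rewrite eq_le le /=.
have [->|a0] := eqVneq a 0.
  by rewrite normr0 mul0r (le_trans _ (opnorm_ub _ (x := 0) _))// normr0.
have := le a^-1 (a *: f); rewrite scalerA mulVf// scale1r normfV.
by rewrite ler_pdivlMl// normr_gt0.
Qed.

Lemma opnorm_eq0 f : opnorm f = 0 -> f = 0.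
Proof.
move=> f0; apply: lincontP => x; apply/normr0_eq0/eqP.
by have := ler_opnorm f x; rewrite f0 mul0r normr_le0 normr_eq0.
Qed.

HB.instance Definition _ :=
  Lmodule_isNormed.Build R lincont opnormD opnormZ opnorm_eq0.

End LinCont.
Arguments lincont {R} V W.

(* Topological dual, with the dual norm. *)
Notation dual V := (lincont V _^o).

Section Transpose.
Context {R : realType} {V W : normedModType R}.

Fact transpose_subproof (B : lincont V W) (g : dual W) :
  (g \o B : V -> R^o) \in lincont_pred.
Proof.
apply/asboolP; split; first by move=> a x y /=; rewrite !linearP.
by move=> x; apply: continuous_comp; exact: lincont_continuous.
Qed.

(* B' : W' -> V' *)
Definition transpose (B : lincont V W) (g : dual W) : dual V :=
  LinCont (transpose_subproof B g).

Fact bidual_subproof (v : V) :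
  ((fun g => g v) : dual V -> R^o) \in lincont_pred.
Proof.
apply: bounded_lincont => //; exists `|v| => g.
by rewrite mulrC ler_opnorm.
Qed.

(* The canonical embedding of V into its bidual. *)
Definition bidual (v : V) : dual (dual V) := LinCont (bidual_subproof v).

End Transpose.

Section Riesz.
Context {R : realType} {V : hilbertType R}.
Implicit Types x y z : V.

Lemma innerC x y : inner x y = inner y x.
Proof. by rewrite hermC expr0 mul1r. Qed.

Lemma inner_linearr x : linear (inner x : V -> R^o).
Proof. by move=> a y z; rewrite linearPr. Qed.

Lemma inner_linearl y : linear (fun x => inner x y : R^o).
Proof. by move=> a x z; rewrite !(innerC _ y) inner_linearr. Qed.

Lemma inner_CauchySchwarz x y : `|inner x y| <= `|x| * `|y|.
Proof.
wlog xy0 : x / 0 <= inner x y => [wlg|].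
  have [/wlg//|/ltW xy0] := leP 0 (inner x y).
  have N : inner (- x) y = - inner x y.
    by rewrite !(innerC _ y) linearNr.
  by have := wlg (- x); rewrite N normrN oppr_ge0 normrN; exact.
rewrite ger0_norm//.
have [->|x0] := eqVneq x 0.
  by rewrite innerC linear0r normr0 mul0r.
have [->|y0] := eqVneq y 0; first by rewrite linear0r normr0 mulr0.
have nx : 0 < `|x| by rewrite normr_gt0.
have ny : 0 < `|y| by rewrite normr_gt0.
have := sqr_ge0 `| `|y| *: x - `|x| *: y |.
rewrite normr_inner -!scaleNr.
rewrite linearDr/= !linearZr/= !(innerC (_ + _)) !linearDr/= !linearZr/=.
rewrite (innerC y x) -!normr_inner => h0.
have h : 0 <= 2 * ((`|x| * `|y|) * (`|x| * `|y| - inner x y)).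
  by apply: le_trans h0 _; rewrite /GRing.scale/=; lra.
have : 0 <= (`|x| * `|y|) * (`|x| * `|y| - inner x y) by lra.
by rewrite pmulr_rge0 ?mulr_gt0// subr_ge0.
Qed.

Fact riesz_subproof x : (inner x : V -> R^o) \in lincont_pred.
Proof.
apply: bounded_lincont; first exact: inner_linearr.
by exists `|x| => y; exact: inner_CauchySchwarz.
Qed.

Definition riesz_fun x : dual V := LinCont (riesz_subproof x).

Fact riesz_fun_subproof : riesz_fun \in lincont_pred.
Proof.
apply: bounded_lincont.
  by move=> a x y; apply: lincontP => z; rewrite /= inner_linearl.
exists 1 => x; apply: opnorm_le => y y1; rewrite mul1r.
by rewrite (le_trans (inner_CauchySchwarz x y))// ler_piMr.
Qed.

(* The Riesz map V -> V', <riesz x, y> = (x, y)_V. *)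
Definition riesz : lincont V (dual V) := LinCont riesz_fun_subproof.

End Riesz.

Section KKT.
Context {R : realType} {W U O : hilbertType R}.
Variables (A : lincont U (dual W)) (T : lincont U O) (alpha : R).

Definition M_op : lincont W (dual W) := riesz.

Definition K_op (u : U) : dual U := transpose T (riesz (T u)).

(* The rows of the block operator; W'' is identified with W through [bidual],
   so that M' and A' are applied to elements of W. *)
Definition kkt (x : W * U * W) : dual W * dual U * dual W :=
  let: (f, u, w) := x in
  (alpha *: M_op f + transpose M_op (bidual w),
   K_op u + transpose A (bidual w),
   M_op f + A u).

Definition pairing (g : dual W * dual U * dual W) (y : W * U * W) : R :=
  g.1.1 y.1.1 + g.1.2 y.1.2 + g.2 y.2.

Lemma pairing_kktE f u w psi phi xi :
  pairing (kkt (f, u, w)) (psi, phi, xi) =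
  alpha * inner f psi + inner psi w + inner (T u) (T phi) + A phi w
  + inner f xi + A u xi.
Proof. by rewrite /pairing /= !addrA. Qed.

Definition norm_Walpha (f : W) : R := Num.sqrt (alpha * `|f| ^+ 2).

Definition norm_Ualpha (u : U) : R :=
  Num.sqrt (alpha * `|A u| ^+ 2 + `|T u| ^+ 2).

Definition norm_Walphainv (w : W) : R := Num.sqrt (alpha^-1 * `|w| ^+ 2).

Definition norm_V (x : W * U * W) : R :=
  Num.sqrt (norm_Walpha x.1.1 ^+ 2 + norm_Ualpha x.1.2 ^+ 2
            + norm_Walphainv x.2 ^+ 2).

End KKT.

(* Main.v *)
Require Import Defs.
From HB Require Import structures.
From mathcomp Require Import all_boot all_order all_algebra.
From mathcomp Require Import all_classical all_reals all_analysis.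
From mathcomp Require Import ring lra.
Set Implicit Arguments.
Unset Strict Implicit.
Unset Printing Implicit Defensive.
Import Order.TTheory GRing.Theory Num.Theory.
Import numFieldNormedType.Exports.
Local Open Scope classical_set_scope.
Local Open Scope ring_scope.

(** The supremum is bounded above by Cauchy-Schwarz in the weighted norms. For
    the lower bound, test [x = (f, u, w)] against
    [y = (f + w / alpha, u, alpha xi - w)], where [xi] is an almost-norming
    vector for the functional [A u], scaled to have norm at most [|A u|]. The
    mixed terms [<A u, w>] cancel and what remains is a positive definite
    quadratic form in the component norms of [x], with coefficients that do not
    depend on [alpha]. Almost-norming vectors replace the Riesz representative
    of [A u]. *)

(** The dual norm is a supremum over the unit ball, so some [x] there has [|g x|] at least [t] times
    the norm of [g]. Rescaling [x] by that norm and the sign of [g x] gives [v]. *)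
Lemma dual_almost_norming (R : realType) (V : normedModType R) (g : dual V)
    (t : R) : t < 1 -> exists2 v : V, `|v| <= `|g| & t * `|g| ^+ 2 <= g v.
Proof.
move=> t1; have [->|g0] := eqVneq g 0.
  by exists 0; rewrite ?normr0// expr0n mulr0 linear0.
have ng : 0 < `|g| by rewrite normr_gt0.
have e0 : 0 < (1 - t) * `|g| by rewrite mulr_gt0// subr_gt0.
have [_ [x /= x1 <-]] := sup_adherent e0 (opnorm_has_sup g).
rewrite -[sup _]/(`|g|) => gx.
have {}gx : t * `|g| <= `|g x| by apply/ltW; move: gx; lra.
exists ((`|g| * Num.sg (g x)) *: x).
  rewrite normrZ normrM normr_id normr_sg -mulrA ler_piMr//.
  by case: (g x != 0); rewrite ?mul1r ?mul0r.
rewrite linearZ/= /GRing.scale/= -mulrA -normrEsg expr2 mulrCA.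
by rewrite ler_wpM2l.
Qed.

Section WeightedNorm.
Context {R : realType} {W U O : hilbertType R}.
Variables (A : lincont U (dual W)) (T : lincont U O).

(** Writing [alpha] as [s ^+ 2] turns the weights on the component norms into [s] and its inverse,
    which leaves cross terms rational in [s]. *)
Lemma norm_VE (s : R) (f : W) (u : U) (w : W) : 0 < s ->
  norm_V A T (s ^+ 2) (f, u, w) =
  Num.sqrt ((s * `|f|) ^+ 2 + ((s * `|A u|) ^+ 2 + `|T u| ^+ 2)
            + (`|w| / s) ^+ 2).
Proof.
move=> s0; rewrite /norm_V /norm_Walpha /norm_Ualpha /norm_Walphainv /=.
by rewrite !sqr_sqrtr ?addr_ge0 ?mulr_ge0 ?invr_ge0 ?exprn_ge0// ?ltW//
  !exprMn exprVn [_ ^- 2 * _]mulrC.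
Qed.

Lemma norm_V_ge0 (a : R) x : 0 <= norm_V A T a x.
Proof. exact: sqrtr_ge0. Qed.

(** The norm sees [u] only through [A u] and [T u], so the joint kernel must be trivial.
    Definiteness keeps the denominators of the quotient positive. *)
Lemma norm_V_eq0 (a : R) x : (forall u, A u = 0 -> T u = 0 -> u = 0) ->
  0 < a -> norm_V A T a x = 0 -> x = 0.
Proof.
case: x => [[f u] w] kerAT a0.
have s0 : 0 < Num.sqrt a by rewrite sqrtr_gt0.
rewrite -(sqr_sqrtr (ltW a0)) norm_VE// => /eqP; rewrite sqrtr_eq0 => le0.
have := sqr_ge0 (Num.sqrt a * `|f|); have := sqr_ge0 (Num.sqrt a * `|A u|).
have := sqr_ge0 `|T u|; have := sqr_ge0 (`|w| / Num.sqrt a) => w2 t2 g2 f2.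
have /eqP : (Num.sqrt a * `|f|) ^+ 2 = 0 by lra.
have /eqP : (Num.sqrt a * `|A u|) ^+ 2 = 0 by lra.
have /eqP : `|T u| ^+ 2 = 0 by lra.
have /eqP : (`|w| / Num.sqrt a) ^+ 2 = 0 by lra.
rewrite !expf_eq0/= !mulf_eq0 invr_eq0 !normr_eq0 (gt_eqF s0) !orbF/=.
by move=> /eqP-> /eqP Tu /eqP Au /eqP->; rewrite (kerAT u).
Qed.

Lemma norm_V_components (s : R) (f : W) (u : U) (w : W) : 0 < s ->
  [/\ s * `|f| <= norm_V A T (s ^+ 2) (f, u, w),
      s * `|A u| <= norm_V A T (s ^+ 2) (f, u, w),
      `|T u| <= norm_V A T (s ^+ 2) (f, u, w) &
      `|w| / s <= norm_V A T (s ^+ 2) (f, u, w)].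
Proof.
move=> s0; rewrite norm_VE//.
have le_sqrt (a b : R) : a ^+ 2 <= b -> a <= Num.sqrt b.
  by move=> ab; rewrite (le_trans (ler_norm a))// -sqrtr_sqr ler_wsqrtr.
have := sqr_ge0 (s * `|f|); have := sqr_ge0 (s * `|A u|).
have := sqr_ge0 `|T u|; have := sqr_ge0 (`|w| / s).
set F := s * `|f|; set G := s * `|A u|; set Z := `|w| / s => Z2 T2 G2 F2.
by split; apply: le_sqrt; lra.
Qed.

(** The pairing has six terms. In each, the weights match up so that Cauchy-Schwarz or the operator
    norm bounds it by one component norm of [x] times one of [y]; hence the 6. *)
Lemma pairing_kkt_le (s : R) (x y : W * U * W) : 0 < s ->
  pairing (kkt A T (s ^+ 2) x) y <=
  6 * (norm_V A T (s ^+ 2) x * norm_V A T (s ^+ 2) y).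
Proof.
case: x y => [[f u] w] [[p q] z] s0; rewrite pairing_kktE.
have [] := norm_V_components p q z s0.
have [] := norm_V_components f u w s0.
set X := norm_V _ _ _ _; set Y := norm_V _ _ _ _ => fX AX TX wX pY AY TY zY.
have sn0 : s != 0 by rewrite gt_eqF.
have s1 : 0 <= s by exact: ltW.
have prod a b : 0 <= a -> 0 <= b -> a <= Y -> b <= X -> b * a <= X * Y.
  by move=> ? ? ? ?; rewrite ler_pM.
have f0 : 0 <= s * `|f| by rewrite mulr_ge0.
have p0 : 0 <= s * `|p| by rewrite mulr_ge0.
have Au0 : 0 <= s * `|A u| by rewrite mulr_ge0.
have Aq0 : 0 <= s * `|A q| by rewrite mulr_ge0.
have w0 : 0 <= `|w| / s by rewrite divr_ge0.
have z0 : 0 <= `|z| / s by rewrite divr_ge0.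
have h1 := prod _ _ p0 f0 pY fX.
have h2 := prod _ _ p0 w0 pY wX.
have h3 := prod _ _ (normr_ge0 (T q)) (normr_ge0 (T u)) TY TX.
have h4 := prod _ _ Aq0 w0 AY wX.
have h5 := prod _ _ z0 f0 zY fX.
have h6 := prod _ _ z0 Au0 zY AX.
have e1 : s ^+ 2 * inner f p <= s * `|f| * (s * `|p|).
  rewrite mulrACA -expr2 ler_wpM2l ?sqr_ge0//.
  exact: le_trans (ler_norm _) (inner_CauchySchwarz _ _).
have e2 : inner p w <= `|w| / s * (s * `|p|).
  rewrite mulrA divfK// mulrC.
  exact: le_trans (ler_norm _) (inner_CauchySchwarz _ _).
have e3 := le_trans (ler_norm _) (inner_CauchySchwarz (T u) (T q)).
have e4 : A q w <= `|w| / s * (s * `|A q|).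
  rewrite mulrA divfK// mulrC.
  exact: le_trans (ler_norm _) (ler_opnorm _ _).
have e5 : inner f z <= s * `|f| * (`|z| / s).
  have -> : s * `|f| * (`|z| / s) = `|f| * `|z| by field.
  exact: le_trans (ler_norm _) (inner_CauchySchwarz _ _).
have e6 : A u z <= s * `|A u| * (`|z| / s).
  have -> : s * `|A u| * (`|z| / s) = `|A u| * `|z| by field.
  exact: le_trans (ler_norm _) (ler_opnorm _ _).
lra.
Qed.

(** The 1/8 is what is left of the squares of [|A u|] and [|w|] (weighted) once the mixed terms are
    absorbed; more is left of the other two squares. *)
Lemma kkt_test_vector (s : R) (x : W * U * W) : 0 < s -> exists y,
  norm_V A T (s ^+ 2) y <= 2 * norm_V A T (s ^+ 2) x /\
  norm_V A T (s ^+ 2) x ^+ 2 / 8 <= pairing (kkt A T (s ^+ 2) x) y.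
Proof.
case: x => [[f u] w] s0.
have sn0 : s != 0 by rewrite gt_eqF.
have s1 : 0 <= s by exact: ltW.
have is1 : 0 <= s^-1 by rewrite invr_ge0.
(* The form [F^2 - F Z + Z^2 - F G + t G^2] is positive definite for every [t] above 1/3; 3/4 leaves
   room for the factor 1/8. *)
have lt1 : 3 / 4 < 1 :> R by lra.
have [v vA Av] := dual_almost_norming (A u) lt1.
(* The term in [w / s^2] produces the square of [|w| / s], and [s^2 v] produces 3/4 of that of
   [s |A u|]. The [- w] cancels [A u w] and one of the two copies of [inner f w]. *)
exists (f + s ^- 2 *: w, u, s ^+ 2 *: v - w).
have F0 : 0 <= s * `|f| by rewrite mulr_ge0.
have G0 : 0 <= s * `|A u| by rewrite mulr_ge0.
have Z0 : 0 <= `|w| / s by rewrite mulr_ge0.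
have T0 := sqr_ge0 `|T u|.
split.
  have P1 : s * `|f + s ^- 2 *: w| <= s * `|f| + `|w| / s.
    have -> : s * `|f| + `|w| / s = s * (`|f| + s ^- 2 * `|w|) by field.
    rewrite ler_wpM2l// (le_trans (ler_normD _ _))// normrZ ger0_norm//.
    by rewrite invr_ge0 exprn_ge0.
  have P2 : `|s ^+ 2 *: v - w| / s <= s * `|A u| + `|w| / s.
    have -> : s * `|A u| + `|w| / s = (s ^+ 2 * `|A u| + `|w|) / s by field.
    rewrite ler_wpM2r// (le_trans (ler_normB _ _))// normrZ.
    by rewrite ger0_norm ?exprn_ge0// lerD2r ler_wpM2l// exprn_ge0.
  have P0 : 0 <= s * `|f + s ^- 2 *: w| by rewrite mulr_ge0.
  have Q0 : 0 <= `|s ^+ 2 *: v - w| / s by rewrite mulr_ge0.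
  rewrite !norm_VE//; move: P0 P1 Q0 P2 F0 G0 Z0 T0.
  set F := s * `|f|; set G := s * `|A u|; set Z := `|w| / s.
  set P := s * _; set Q := _ / s => P0 P1 Q0 Q1 F0 G0 Z0 T0.
  have P2 : P ^+ 2 <= (F + Z) ^+ 2 by rewrite ler_sqr ?nnegrE ?addr_ge0.
  have Q2 : Q ^+ 2 <= (G + Z) ^+ 2 by rewrite ler_sqr ?nnegrE ?addr_ge0.
  rewrite -ler_sqr ?nnegrE ?mulr_ge0 ?sqrtr_ge0// [leRHS]exprMn.
  (* These squares bound the squared norm of the test vector by [2 F^2 + 3 G^2 + 4 Z^2 + |T u|^2];
     the coefficient 4 gives the factor 2. *)
  have := sqr_ge0 (F - Z); have := sqr_ge0 (G - Z).
  have := sqr_ge0 F; have := sqr_ge0 G; have := sqr_ge0 Z.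
  have := sqr_ge0 P; have := sqr_ge0 Q.
  move=> *; rewrite !sqr_sqrtr; [nra|lra|lra].
rewrite norm_VE// sqr_sqrtr ?addr_ge0 ?sqr_ge0// pairing_kktE.
rewrite !linearDr/= !linearZr/= [inner (f + _) w]innerC !linearDr/= !linearZr/=.
rewrite !linearB/= !linearZ/= (innerC w f) !linearNr/= -!normr_inner.
rewrite /GRing.scale/=.
have FW : - ((s * `|f|) * (`|w| / s)) <= inner f w.
  have -> : s * `|f| * (`|w| / s) = `|f| * `|w| by field.
  by have := inner_CauchySchwarz f w; rewrite ler_norml => /andP[].
have FG : - ((s * `|f|) * (s * `|A u|)) <= s ^+ 2 * inner f v.
  have -> : s * `|f| * (s * `|A u|) = s ^+ 2 * (`|f| * `|A u|) by ring.
  rewrite -mulrN ler_wpM2l ?exprn_ge0//.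
  have := inner_CauchySchwarz f v; rewrite ler_norml => /andP[+ _].
  by apply: le_trans; rewrite lerN2 ler_wpM2l.
have GG : 3 / 4 * (s * `|A u|) ^+ 2 <= s ^+ 2 * A u v.
  by rewrite exprMn mulrCA ler_wpM2l ?exprn_ge0.
have FF : s ^+ 2 * `|f| ^+ 2 = (s * `|f|) ^+ 2 by rewrite exprMn.
have WW : s ^- 2 * `|w| ^+ 2 = (`|w| / s) ^+ 2 by field.
have c1 : s ^+ 2 * (s ^- 2 * inner f w) = inner f w by field.
rewrite FF c1 WW.
set F := s * `|f| in FW FG *; set G := s * `|A u| in FG GG *.
set Z := `|w| / s in FW *.
(* complete the squares in [F^2 - F Z + Z^2 - F G + 3/4 G^2] *)
have := sqr_ge0 (F / 2 - 7 / 8 * Z); have := sqr_ge0 (F / 2 - 5 / 8 * G).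
have := sqr_ge0 F; nra.
Qed.

End WeightedNorm.

Theorem theorem6p1 (R : realType) (W U O : hilbertType R)
    (A : lincont U (dual W)) (T : lincont U O)
    (A_closed_range : closed (range A))
    (T_Ker : exists c2 : R, forall u : U, A u = 0 -> `|u| <= c2 * `|T u|) :
  exists c C : R, [/\ 0 < c, 0 < C &
    forall alpha : R, 0 < alpha -> forall x : W * U * W, x != 0 ->
      (c%:E <= ereal_sup
         [set (pairing (kkt A T alpha x) y /
               (norm_V A T alpha x * norm_V A T alpha y))%:E
         | y in [set y : W * U * W | y != 0%R]]
       <= C%:E)%E].
Proof.
have kerAT u : A u = 0 -> T u = 0 -> u = 0.
  case: T_Ker => c2 Tc2 /Tc2 + Tu; rewrite Tu normr0 mulr0 normr_le0.
  by move/eqP.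
(* 1/16 is the lower bound 1/8 divided by the factor 2 in the norm of the test vector. *)
exists (1 / 16), 6; split; [lra|lra|] => alpha a0 x x0.
have norm_gt0 z : z != 0 -> 0 < norm_V A T alpha z.
  move=> z0; rewrite lt_neqAle norm_V_ge0 andbT eq_sym.
  by apply: contraNneq z0 => /(norm_V_eq0 kerAT a0)->.
have s0 : 0 < Num.sqrt alpha by rewrite sqrtr_gt0.
have sE := sqr_sqrtr (ltW a0); apply/andP; split; last first.
  apply: ge_ereal_sup => _ [y /= y0 <-]; rewrite lee_fin.
  rewrite ler_pdivrMr ?mulr_gt0 ?norm_gt0//.
  by have := pairing_kkt_le A T x y s0; rewrite sE.
have [y] := kkt_test_vector A T x s0; rewrite sE => -[yx xy].
have X0 := norm_gt0 _ x0.
(* The supremum runs over nonzero vectors. A zero [y] would make the pairing vanish, against its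
   positive lower bound. *)
have y0 : y != 0.
  apply: contraTneq xy => ->; rewrite -ltNge.
  have -> : pairing (kkt A T alpha x) 0 = 0.
    by rewrite /pairing /= !linear0 !addr0.
  by rewrite mulr_gt0 ?exprn_gt0.
apply: le_trans (ereal_sup_ubound _); last by exists y.
rewrite lee_fin ler_pdivlMr ?mulr_gt0 ?norm_gt0//.
apply: le_trans xy; nra.
Qed.
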